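(* Let $G=D(n,l)$ be the Dandelion graph, and let $\Delta(G)$ denote its maximum degree. Then $$es(G)=n-l+1\quad\text{for }\Delta(G)\ge \left\lceil \frac{|E(G)|+1}{2}\right\rceil .$$ For $\Delta(G)<\left\lceil \frac{|E(G)|+1}{2}\right\rceil$, $$\left\lceil \frac{n}{2}\right\rceil\le es(G)\le n-l+\left\lceil \frac{l}{2}\right\rceil .$$
   Context: Graphs are simple, undirected and connected; $V(G)$ and $E(G)$ denote the vertex set and edge set of $G$. For a graph $G$ and a positive integer $k$, a vertex $k$-labeling is a map $\phi:V(G)\to\{1,2,\ldots,k\}$. The weight of an edge $xy$ is $w_\phi(xy)=\phi(x)+\phi(y)$. A vertex $k$-labeling $\phi$ is called an edge irregular $k$-labeling if $w_\phi(e)\ne w_\phi(f)$ for every two different edges $e,f$ of $G$. The edge irregularity strength $es(G)$ is the minimum $k$ for which $G$ has an edge irregular $k$-labeling. The Dandelion graph $D(n,l)$ is the graph on $n$ vertices consisting of a copy of the star $S_{n-l}$ (a center vertex joined to $n-l$ leaves) and a copy of a path on the $l$ vertices $p_0,p_1,\ldots,p_{l-1}$, where $p_0$ is identified with the star center. Explicitly, its vertex set is $\{x_i:1\le i\le n-l\}\cup\{p_j:0\le j\le l-1\}$, and its edge set is $\{p_0x_i:1\le i\le n-l\}\cup\{p_jp_{j+1}:0\le j\le l-2\}$.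
   Formalization: The equality es(G) = n-l+1 is stated for 1 < l < n only: it fails for the stars D(n,1), n ≥ 2, where es = n-1, and for the paths D(3,3) and D(4,4), where es = 2; the single edge D(2,2) is also left out. *)

(* Defs.v *)
From mathcomp Require Import all_boot.
From mathcomp Require Import zify.

Set Implicit Arguments.
Unset Strict Implicit.
Unset Printing Implicit Defensive.

(* Finite simple undirected graphs. *)
Record sgraph := SGraph {
  vertex :> finType;
  adj : rel vertex;
  adj_sym : symmetric adj;
  adj_irrefl : irreflexive adj
}.

Definition connected_graph (G : sgraph) : Prop :=
  0 < #|G| /\ forall x y : G, connect (@adj G) x y.

(* An edge xy is the two-element set {x, y}. *)
Definition edges (G : sgraph) : {set {set G}} :=
  [set [set p.1; p.2] | p : G * G & adj p.1 p.2].

Definition degree (G : sgraph) (x : G) : nat := #|[set y | adj x y]|.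

Definition max_degree (G : sgraph) : nat := \max_(x : G) degree x.

(* On an edge e = {x, y} (with x != y) the sum is phi x + phi y. *)
Definition edge_weight (G : sgraph) (phi : G -> nat) (e : {set G}) : nat :=
  \sum_(x in e) phi x.

Lemma edge_weight2 (G : sgraph) (phi : G -> nat) (x y : G) :
  adj x y -> edge_weight phi [set x; y] = phi x + phi y.
Proof.
move=> xy; have nxy : x != y by apply: contraTneq xy => ->; rewrite adj_irrefl.
by rewrite /edge_weight big_setU1 ?inE //= big_set1.
Qed.

Definition edge_irregular (G : sgraph) (phi : G -> nat) : bool :=
  [forall e in edges G, forall f in edges G,
    (e != f) ==> (edge_weight phi e != edge_weight phi f)].

(* Labels lie in {1, ..., k}: 'I_k.+1 gives the upper bound, and 0 is excluded
   explicitly. *)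
Definition has_edge_irregular_labeling (G : sgraph) (k : nat) : bool :=
  (0 < k) &&
  [exists phi : {ffun G -> 'I_k.+1},
     [forall x : G, 0 < phi x] && edge_irregular (fun x => phi x : nat)].

Lemma binary_sum_inj (N : nat) (b c : nat -> bool) :
  \sum_(i < N) b i * 2 ^ i = \sum_(i < N) c i * 2 ^ i ->
  forall i, i < N -> b i = c i.
Proof.
elim: N b c => [|N IH] b c //.
have E (d : nat -> bool) : \sum_(i < N.+1) d i * 2 ^ i =
    d 0 + (\sum_(i < N) d i.+1 * 2 ^ i).*2.
  rewrite big_ord_recl expn0 muln1 -muln2 big_distrl /=; congr addn.
  by apply: eq_bigr => i _; rewrite /bump add1n expnS; lia.
rewrite !E => eq_bc [|i] ltiN.
  by have := congr1 odd eq_bc; rewrite !oddD !odd_double !addbF !oddb.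
apply: (IH (fun j => b j.+1) (fun j => c j.+1)) => //.
have := congr1 half eq_bc.
by rewrite !half_bit_double.
Qed.

Lemma ex_edge_irregular_labeling (G : sgraph) :
  exists k, has_edge_irregular_labeling G k.
Proof.
exists (2 ^ #|G|); apply/andP; split; first by rewrite expn_gt0.
have lab (x : G) : 2 ^ enum_rank x < (2 ^ #|G|).+1.
  by rewrite ltnS leq_pexp2l // ltnW.
apply/existsP; exists [ffun x => Ordinal (lab x)].
apply/andP; split; first by apply/forallP => x; rewrite ffunE /= expn_gt0.
have W (e : {set G}) :
    edge_weight (fun x => [ffun x => Ordinal (lab x)] x : nat) e =
    \sum_(i < #|G|) [exists x in e, enum_rank x == i :> nat] * 2 ^ i.
  rewrite /edge_weight (reindex _ (onW_bij _ (@enum_val_bij G))) /=.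
  rewrite big_mkcond; apply: eq_bigr => i _; rewrite ffunE /= enum_valK.
  suff -> : [exists x in e, enum_rank x == i :> nat] = (enum_val i \in e).
    by case: ifP; rewrite ?mul1n.
  apply/existsP/idP => [[x /andP[xe /eqP/val_inj <-]]|ie].
    by rewrite enum_rankK.
  by exists (enum_val i); rewrite ie enum_valK /=.
apply/forall_inP => e _; apply/forall_inP => f _; apply/implyP.
apply: contra_neq; rewrite !W => /(@binary_sum_inj #|G|
  (fun i => [exists x in e, enum_rank x == i :> nat])
  (fun i => [exists x in f, enum_rank x == i :> nat])) ef.
have H (g : {set G}) (x : G) :
    [exists y in g, enum_rank y == enum_rank x :> nat] = (x \in g).
  apply/existsP/idP => [[y /andP[yg /eqP/val_inj/enum_rank_inj <-]]|xg] //.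
  by exists x; rewrite xg /=.
by apply/setP => x; rewrite -!H ef.
Qed.

(* The edge irregularity strength es(G). *)
Definition es (G : sgraph) : nat := ex_minn (ex_edge_irregular_labeling G).

(* The Dandelion graph D(n, l).  inl i is the leaf x_(i+1) and inr j is the path
   vertex p_j, so the star center is the inr j with j = 0.  Subtraction being
   truncated, this is D(n, l) only for 1 <= l <= n. *)
Definition dandelion_adj (n l : nat) : rel ('I_(n - l) + 'I_l)%type :=
  fun u v =>
    match u, v with
    | inl _, inl _ => false
    | inl _, inr j => j == 0 :> nat
    | inr j, inl _ => j == 0 :> nat
    | inr i, inr j => (j == i.+1 :> nat) || (i == j.+1 :> nat)
    end.

Lemma dandelion_adj_sym (n l : nat) : symmetric (@dandelion_adj n l).
Proof. by move=> [i|i] [j|j] //=; rewrite orbC. Qed.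

Lemma dandelion_adj_irrefl (n l : nat) : irreflexive (@dandelion_adj n l).
Proof. by move=> [i|i] //=; apply/negbTE; lia. Qed.

Definition dandelion (n l : nat) : sgraph :=
  SGraph (@dandelion_adj_sym n l) (@dandelion_adj_irrefl n l).

Lemma card_dandelion (n l : nat) : l <= n -> #|dandelion n l| = n.
Proof. by move=> ln; rewrite card_sum !card_ord subnK. Qed.

Lemma dandelion_connected (n l : nat) :
  0 < l -> connected_graph (dandelion n l).
Proof.
move=> l0; split; first by rewrite card_sum !card_ord addn_gt0 l0 orbT.
pose r : dandelion n l := inr (Ordinal l0).
have csym := sym_connect_sym (@adj_sym (dandelion n l)).
suff H x : connect (@adj (dandelion n l)) r x.
  by move=> x y; apply: connect_trans (H y); rewrite csym.
case: x => [i|[j jl]]; first by apply: connect1.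
elim: j jl => [|j IH] jl.
  by rewrite (_ : inr _ = r) //; congr inr; apply: val_inj.
apply: connect_trans (IH (ltnW jl)) _; apply: connect1.
by rewrite /= eqxx.
Qed.

(* Main.v *)
Require Import Defs.
From mathcomp Require Import all_boot.
From mathcomp Require Import zify.

(** The lower bounds hold in every graph.  The neighbours of a vertex get
    pairwise different labels in an edge irregular labeling, so no degree
    exceeds the edge irregularity strength ([degree_le_es]); and the weights,
    which lie in {2, ..., 2k}, are pairwise different, so there are at most
    2k - 1 edges ([card_edges_lt_es]).  In the dandelion the center has
    n - l + 1 neighbours when 1 < l, and there are n - 1 edges, since sending a
    vertex other than p_0 to the edge towards p_0 is injective
    ([card_le_edges]).

    For the upper bounds the dandelion is seen as a tree rooted at its center
    p_0: every edge joins a vertex other than the root to its parent, so a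
    labeling is edge irregular as soon as the sum of the labels of a vertex and
    of its parent determines the vertex ([es_le_parent]).  Two labelings with
    this property are used.

    - Put m = n - l and k = m + 1.  Label p_0 by 1, the leaves by 1, ..., m, and
      the path from p_1 on by k, k, k-1, k-1, k-2, ...  The star edges get
      2, ..., k, the edge p_0 p_1 gets k + 1, and the rest of the path gets
      2k, 2k-1, 2k-2, ...; these last l - 2 weights stay above k + 1 exactly
      when l <= m + 2, and this is what the condition on the maximum degree
      m + 1 ([max_degree_dandelion]) amounts to ([es_dandelion_le_star]).
    - Label the path, from its free end to p_0, by 1, 1, 2, 2, ..., so that its
      edges get 2, ..., l and p_0 gets the ceiling c of l/2; then label the
      leaves by c + 1, ..., c + m, whose edges get weights above 2c >= l
      ([es_dandelion_le_path]). *)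

Set Implicit Arguments.
Unset Strict Implicit.
Unset Printing Implicit Defensive.

(** * Edge irregularity strength of an arbitrary graph *)

Section Strength.

Variable G : sgraph.

Lemma mem_edges (x y : G) : adj x y -> [set x; y] \in edges G.
Proof. by move=> xy; apply/imsetP; exists (x, y); rewrite ?inE. Qed.

Lemma edgesP (e : {set G}) :
  e \in edges G -> exists x y : G, adj x y /\ e = [set x; y].
Proof. by case/imsetP => -[x y]; rewrite inE /= => xy ->; exists x, y. Qed.

Lemma edge_irregular_inj (phi : G -> nat) :
  edge_irregular phi -> {in edges G &, injective (edge_weight phi)}.
Proof.
move=> /forall_inP irr e f eG fG; apply: contra_eq => nef.
by have /forall_inP/(_ f fG)/implyP/(_ nef) := irr e eG.
Qed.

Lemma es_labeling : exists phi : G -> nat,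
  (forall x, 0 < phi x <= es G) /\ {in edges G &, injective (edge_weight phi)}.
Proof.
rewrite /es; case: ex_minnP => k /andP[_ /existsP[phi /andP[/forallP pos irr]]] _.
exists (fun x => phi x : nat); split; last exact: edge_irregular_inj.
by move=> x; rewrite pos -ltnS ltn_ord.
Qed.

Lemma es_gt0 : 0 < es G.
Proof. by rewrite /es; case: ex_minnP => k /andP[]. Qed.

Lemma es_le (k : nat) (phi : G -> nat) : 0 < k ->
  (forall x, 0 < phi x <= k) -> {in edges G &, injective (edge_weight phi)} ->
  es G <= k.
Proof.
move=> k0 bnd inj; rewrite /es; case: ex_minnP => es' _; apply.
rewrite /has_edge_irregular_labeling k0 /=; apply/existsP.
have phiE x : [ffun x => inord (phi x) : 'I_k.+1] x = phi x :> nat.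
  by rewrite ffunE inordK // ltnS; case/andP: (bnd x).
exists [ffun x => inord (phi x)]; apply/andP; split.
  by apply/forallP => x; rewrite phiE; case/andP: (bnd x).
apply/forall_inP => e eG; apply/forall_inP => f fG; apply/implyP.
apply: contra_neq; rewrite /edge_weight.
under eq_bigr do rewrite phiE; under [in RHS]eq_bigr do rewrite phiE.
exact: inj.
Qed.

(** Two neighbours of [x] with one label would give two edges of one weight. *)
Lemma degree_le_es (x : G) : degree x <= es G.
Proof.
have [phi [bnd inj]] := es_labeling.
have lab y : (phi y).-1 < es G by have := bnd y; lia.
rewrite /degree -[leqRHS]card_ord.
apply: (@leq_card_in _ _ (fun y => Ordinal (lab y))) => y z.
rewrite !inE => xy xz [eq_lab].
have yz : phi y = phi z by have := bnd y; have := bnd z; lia.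
have /setP/(_ y) : [set x; y] = [set x; z].
  by apply: inj; rewrite ?mem_edges // !edge_weight2 // yz.
rewrite !inE eqxx orbT => /esym/orP[] /eqP // eyx.
by rewrite eyx adj_irrefl in xy.
Qed.

Lemma card_edges_lt_es : #|edges G| < (es G).*2.
Proof.
have [phi [bnd inj]] := es_labeling.
have wgt e : e \in edges G -> 2 <= edge_weight phi e <= (es G).*2.
  case/edgesP => x [y [xy ->]]; rewrite edge_weight2 //.
  by have := bnd x; have := bnd y; lia.
have := es_gt0; case Ek: (es G) => [//|k] _; rewrite doubleS !ltnS.
rewrite -[leqRHS]card_ord.
(* The weights 2, ..., 2k+2 are shifted to start at 0. *)
apply: (@leq_card_in _ _ (fun e => inord (edge_weight phi e - 2))) => e f eG fG.
have := wgt e eG; have := wgt f fG; rewrite Ek => we wf.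
move/(congr1 val); rewrite /= !inordK; try lia.
by move=> eqw; apply: inj => //; lia.
Qed.

(** * Graphs with a parent map *)

Variables (r : G) (parent : G -> G).

(** A height that decreases towards the root keeps [{v, parent v}] from being
    [{w, parent w}] with the roles of the two ends exchanged. *)
Lemma card_le_edges (height : G -> nat) :
  (forall v, v != r -> adj v (parent v)) ->
  (forall v, v != r -> height (parent v) < height v) ->
  #|G| <= #|edges G|.+1.
Proof.
move=> par_adj par_lt.
rewrite (cardD1 r) inE add1n ltnS.
have inj : {in [predD1 G & r] &, injective (fun v => [set v; parent v])}.
  move=> v w; rewrite !inE !andbT => vr wr /setP eqvw.
  have := eqvw v; rewrite !inE eqxx => /esym/orP[] /eqP // vw.
  have := eqvw w; rewrite !inE eqxx => /orP[] /eqP // wv.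
  by have := par_lt v vr; have := par_lt w wr; rewrite -wv -vw; lia.
rewrite -(card_in_imset inj); apply/subset_leq_card/subsetP => e.
case/imsetP => v; rewrite !inE andbT => vr ->.
by apply: mem_edges; apply: par_adj.
Qed.

Lemma es_le_parent (k : nat) (phi : G -> nat) : 0 < k ->
  (forall u v, adj u v ->
     v != r /\ u = parent v \/ u != r /\ v = parent u) ->
  (forall x, 0 < phi x <= k) ->
  (forall v w, v != r -> w != r ->
     phi v + phi (parent v) = phi w + phi (parent w) -> v = w) ->
  es G <= k.
Proof.
move=> k0 adj_par bnd inj; apply: (es_le k0 bnd).
have child e : e \in edges G -> exists2 v, v != r &
    e = [set v; parent v] /\ edge_weight phi e = phi v + phi (parent v).
  case/edgesP => x [y [xy ->]]; rewrite edge_weight2 //.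
  by case: (adj_par x y xy) => -[nr ->];
     [exists y; rewrite // setUC addnC | exists x].
move=> e f /child[v vr [-> ->]] /child[w wr [-> ->]] eqw.
by rewrite (inj v w vr wr eqw).
Qed.

End Strength.

(** * The dandelion as a rooted tree *)

Section Dandelion.

Variables (n l : nat) (l_gt0 : 0 < l).

Let D := dandelion n l.

Definition center : D := inr (Ordinal l_gt0).

Definition dandelion_parent (v : D) : D :=
  match v with
  | inl _ => center
  | inr j => inr (Ordinal (leq_ltn_trans (leq_pred j) (ltn_ord j)))
  end.

Lemma center_neq_path (j : 'I_l) : (inr j != center) = (0 < j).
Proof. by rewrite lt0n. Qed.

Lemma dandelion_parent_adj (v : D) : v != center -> adj v (dandelion_parent v).
Proof. by case: v => [i|j] //; rewrite center_neq_path /=; lia. Qed.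

Lemma dandelion_adj_parent (u v : D) : adj u v ->
  v != center /\ u = dandelion_parent v \/ u != center /\ v = dandelion_parent u.
Proof.
case: u v => [i|i] [j|j] //=.
- by move=> j0; right; split=> //; congr inr; apply: val_inj; apply/eqP.
- by move=> i0; left; split=> //; congr inr; apply: val_inj; apply/eqP.
- case/orP => /eqP e; [left|right]; rewrite center_neq_path; (split; first by rewrite e).
    by congr inr; apply: val_inj; rewrite /= e.
  by congr inr; apply: val_inj; rewrite /= e.
Qed.

Lemma card_dandelion_edges : l <= n -> n <= #|edges D|.+1.
Proof.
move=> ln; rewrite -{1}(card_dandelion ln).
pose height (v : D) : nat := if v is inr j then j else 1.
apply: (card_le_edges (r := center) (height := height) dandelion_parent_adj).
by case=> [i|j] //; rewrite center_neq_path /=; lia.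
Qed.

(** Edge irregularity becomes arithmetic of numbers: as [g 0] is the label of
    the center, an edge at a leaf weighs [f i + g 0], and an edge of the path
    [g j.+1 + g j]. *)
Lemma es_dandelion_le (k : nat) (f g : nat -> nat) : 0 < k ->
  (forall i, i < n - l -> 0 < f i <= k) ->
  (forall j, j < l -> 0 < g j <= k) ->
  (forall i i', i < n - l -> i' < n - l -> f i = f i' -> i = i') ->
  (forall j j', j.+1 < l -> j'.+1 < l ->
     g j.+1 + g j = g j'.+1 + g j' -> j = j') ->
  (forall i j, i < n - l -> j.+1 < l -> f i + g 0 <> g j.+1 + g j) ->
  es D <= k.
Proof.
move=> k0 fb gb finj ginj fg.
pose phi (v : D) := match v with inl i => f i | inr j => g j end.
apply: (es_le_parent (phi := phi) k0 dandelion_adj_parent).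
  by case=> [i|j] /=; [apply: fb | apply: gb].
case=> [i|[[|j] jl]] [i'|[[|j'] jl']] //; rewrite ?center_neq_path //= => _ _.
- by move/addIn/finj => ii'; congr inl; apply: val_inj; apply: ii'.
- by move/fg; case.
- by move/esym/fg; case.
- by move/(ginj j j' jl jl') => jj'; congr inr; apply: val_inj; rewrite /= jj'.
Qed.

Lemma es_dandelion_le_star : l <= (n - l).+2 -> es D <= n - l + 1.
Proof.
move=> lm; pose k := n - l + 1.
apply: (@es_dandelion_le _ succn (fun j => if j is i.+1 then k - i./2 else 1));
  rewrite /k; first lia; first lia.
- by case=> [|j]; lia.
- lia.
- by case=> [|j] [|j'] /=; lia.
- by move=> i [|j] /=; lia.
Qed.

Lemma es_dandelion_le_path : es D <= n - l + uphalf l.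
Proof.
apply: (@es_dandelion_le _ (fun i => uphalf l + i.+1) (fun j => uphalf (l - j)));
  lia.
Qed.

Lemma degree_center : 1 < l -> n - l < degree center.
Proof.
move=> l1; pose p1 : D := inr (Ordinal l1).
rewrite /degree (cardsD1 p1) inE /= add1n ltnS -[leqLHS]card_ord.
rewrite -(card_imset _ (@inl_inj 'I_(n - l) 'I_l)).
apply/subset_leq_card/subsetP => v /imsetP[i _ ->].
by rewrite !inE.
Qed.

(** Besides leaves, the center sees at most p_1, and another path vertex sees
    at most the two next to it; the leaf that exists when [l < n] makes the
    center the vertex of larger degree. *)
Lemma max_degree_dandelion : l < n -> max_degree D <= n - l + 1.
Proof.
move=> ln; apply/bigmax_leqP => v _; rewrite /degree.
case: v => [i|[[|j] jl]].
- apply: leq_trans (_ : #|{: unit}| <= _); last by rewrite card_unit addn1.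
  apply: (@leq_card_in _ _ (fun=> tt)) => -[a|a] [b|b]; rewrite !inE //=.
  by move=> a0 b0 _; congr inr; apply: val_inj => /=; lia.
- rewrite -[leqRHS]card_ord addn1.
  (* The last slot is the one of p_1. *)
  pose slot (y : D) : 'I_(n - l).+1 :=
    if y is inl i then widen_ord (leqnSn _) i else ord_max.
  apply: (@leq_card_in _ _ slot) => -[a|a] [b|b]; rewrite !inE //=.
  + by move=> _ _ /(congr1 val) /= ab; congr inl; apply: val_inj.
  + by move=> _ _ /(congr1 val) /=; have := ltn_ord a; lia.
  + by move=> _ _ /(congr1 val) /=; have := ltn_ord b; lia.
  + by move=> a1 b1 _; congr inr; apply: val_inj => /=; lia.
- apply: leq_trans (_ : #|{: bool}| <= _); last by rewrite card_bool; lia.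
  pose beyond (y : D) := if y is inr i then j < i else false.
  apply: (@leq_card_in _ _ beyond) => -[a|a] [b|b]; rewrite !inE //=.
  by move=> aj bj ab; congr inr; apply: val_inj; move: aj bj ab => /=; lia.
Qed.

End Dandelion.

Theorem theorem3p3 (n l : nat) (l_ge1 : 1 <= l) (l_le_n : l <= n) :
  (1 < l < n ->
   max_degree (dandelion n l) >= uphalf (#|edges (dandelion n l)| + 1) ->
   es (dandelion n l) = n - l + 1) /\
  (max_degree (dandelion n l) < uphalf (#|edges (dandelion n l)| + 1) ->
   uphalf n <= es (dandelion n l) <= n - l + uphalf l).
Proof.
have cardE := card_dandelion_edges l_ge1 l_le_n.
split=> [/andP[l_gt1 l_lt_n] large|_].
  have := max_degree_dandelion l_ge1 l_lt_n.
  have := degree_center n l_ge1 l_gt1; have := degree_le_es (center n l_ge1).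
  have : l <= (n - l).+2 -> _ := @es_dandelion_le_star n l l_ge1.
  lia.
rewrite es_dandelion_le_path // andbT.
have := card_edges_lt_es (dandelion n l); lia.
Qed.
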